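(* Let $\kappa$ be a positive integer, $\Omega=\{X\in\mathbb{H}^n_+ : \mathrm{diag}(X)=e\}$ and $\mathcal{F}=\{X\in\Omega : \mathrm{rank}(X)\le\kappa\}$, where $e\in\mathbb{R}^n$ is the vector of all ones. Then for any $X\in\Omega$ with eigenvalue decomposition $X=\sum_{i=1}^n\lambda_i(X)u_iu_i^{\mathbb{T}}$, $$\mathrm{dist}(X,\mathcal{F})\le(1+2n)\,\|X-\Pi_{\mathcal{R}}(X)\|_*\quad\text{with}\quad \Pi_{\mathcal{R}}(X):=\sum_{i=1}^{\kappa}\lambda_i(X)u_iu_i^{\mathbb{T}}.$$ In particular, $\Gamma(t)\subseteq\Gamma(0)+(1+2n)\,|t|\,\mathbb{B}_{\mathbb{H}^n}$ for any $t\in\mathbb{R}$, where $\Gamma(t)=\{X\in\Omega : \sum_{i=\kappa+1}^n\sigma_i(X)=t\}$.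
   Context: $\mathbb{H}^n$ is the space of $n\times n$ Hermitian matrices with the trace inner product and Frobenius norm $\|\cdot\|_F$; $\mathbb{H}^n_+$ is the cone of Hermitian positive semidefinite matrices; $\mathrm{diag}(X)$ is the vector of diagonal entries of $X$; $\mathrm{dist}$ is the distance in $\|\cdot\|_F$. $\lambda_1(X)\ge\cdots\ge\lambda_n(X)$ are the eigenvalues of $X$ (with $\lambda_i(X)u_iu_i^{\mathbb{T}}$ taken as $0$ for $i>n$), the $u_i$ are complex orthonormal column vectors and $u_i^{\mathbb{T}}$ denotes the conjugate transpose. $\sigma_1(X)\ge\cdots\ge\sigma_n(X)$ are the singular values, $\|\cdot\|_*$ is the nuclear norm (sum of singular values), empty sums are $0$, and $\mathbb{B}_{\mathbb{H}^n}$ is the closed unit ball of $\mathbb{H}^n$ in $\|\cdot\|_F$ centered at the origin. *)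

(* Defs.v *)
From HB Require Import structures.
From mathcomp Require Import all_boot all_order all_algebra.
From mathcomp Require Import spectral complex.
From mathcomp Require Import boolp classical_sets reals ereal.

Set Implicit Arguments.
Unset Strict Implicit.
Unset Printing Implicit Defensive.

Import Order.TTheory GRing.Theory Num.Theory.

Local Open Scope ring_scope.
Local Open Scope complex_scope.
Local Open Scope sesquilinear_scope.
Local Open Scope classical_set_scope.

Section Definitions.
Variable R : realType.

(* On Hermitian matrices this is the norm of the inner product tr (A B). *)
Definition frobenius n (A : 'M[R[i]]_n) : R :=
  Num.sqrt (complex.Re (\tr (A^t* *m A))).

(* The eigenvalues, with multiplicity, are the roots of the characteristic
   polynomial. Only used on Hermitian matrices: there they are real, so that
   taking real parts loses nothing. *)
Definition eigenvalues n (A : 'M[R[i]]_n) : seq R :=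
  sort >=%R
    [seq complex.Re z | z <- sval (closed_field_poly_normal (char_poly A))].

(* Indices start at 0: lambda A i is the (i+1)-st largest eigenvalue. *)
Definition lambda n (A : 'M[R[i]]_n) (i : nat) : R := (eigenvalues A)`_i.

Definition sigma n (A : 'M[R[i]]_n) (i : nat) : R :=
  Num.sqrt (lambda (A^t* *m A) i).

Definition nuclear n (A : 'M[R[i]]_n) : R := \sum_(0 <= i < n) sigma A i.

(* In the order of R[i], 0 <= z means that z is real and nonnegative. *)
Definition psd n (A : 'M[R[i]]_n) : Prop :=
  A \is hermsymmx /\
  forall v : 'cV[R[i]]_n, 0 <= (v^t* *m A *m v) ord0 ord0.

Definition Omega n : set 'M[R[i]]_n :=
  [set X | psd X /\ forall i : 'I_n, X i i = 1].

Definition lowrank n (kappa : nat) : set 'M[R[i]]_n :=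
  [set X | Omega X /\ (\rank X <= kappa)%N].

Definition dist n (X : 'M[R[i]]_n) (S : set 'M[R[i]]_n) : \bar R :=
  ereal_inf [set (frobenius (X - Y))%:E | Y in S].

Definition orthonormal n (u : 'I_n -> 'cV[R[i]]_n) : Prop :=
  forall i j : 'I_n, (u i)^t* *m u j = (i == j)%:R%:M.

Definition eigen_decomposition n (X : 'M[R[i]]_n) (u : 'I_n -> 'cV[R[i]]_n) :
    Prop :=
  orthonormal u /\ X = \sum_(i < n) (lambda X i)%:C *: (u i *m (u i)^t*).

(* When n < kappa, the terms of index beyond n are absent, hence 0. *)
Definition truncation n (kappa : nat) (X : 'M[R[i]]_n)
    (u : 'I_n -> 'cV[R[i]]_n) : 'M[R[i]]_n :=
  \sum_(i < n | (i < kappa)%N) (lambda X i)%:C *: (u i *m (u i)^t*).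

Definition Gamma n (kappa : nat) (t : R) : set 'M[R[i]]_n :=
  [set X | Omega X /\ \sum_(kappa <= i < n) sigma X i = t].

Definition hermitian_ball n : set 'M[R[i]]_n :=
  [set Z | Z \is hermsymmx /\ frobenius Z <= 1].

End Definitions.

(* Main.v *)
(* Put T for the truncation, A = X - T >= 0 and delta = tr A, which is the
   nuclear norm of A. An entry of a positive semidefinite matrix is bounded by
   any bound on its diagonal, so |A_ij| <= delta. If delta < 1, the diagonal of
   T stays above 1 - delta > 0, and normalizing T to unit diagonal by a
   diagonal congruence gives a feasible Y of rank at most kappa; the factor
   sqrt (T_ii T_jj) lies in [1 - delta, 1] and |Y_ij| <= 1, so this moves each
   entry by at most delta. If delta >= 1, the all-ones matrix Y already has
   |X_ij - Y_ij| <= 2 <= 2 delta. Either way |X_ij - Y_ij| <= 2 delta, whence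
   the Frobenius distance is at most 2 n delta. *)

Require Import Defs.
From HB Require Import structures.
From mathcomp Require Import all_boot all_order all_algebra.
From mathcomp Require Import perm spectral complex.
From mathcomp Require Import boolp classical_sets reals ereal.
From mathcomp Require Import ring.

Set Implicit Arguments.
Unset Strict Implicit.
Unset Printing Implicit Defensive.

Import Order.TTheory GRing.Theory Num.Theory.

Local Open Scope ring_scope.
Local Open Scope complex_scope.
Local Open Scope classical_set_scope.

(** * Rules for conjugate transposes *)

Section Adjoint.
Local Open Scope sesquilinear_scope.
Variable R : realType.
Implicit Types (m n p : nat).

Lemma conjC_realc (x : R) : Num.conj (x%:C : R[i]) = x%:C.
Proof. by apply: conj_Creal; apply/complex_realP; exists x. Qed.

Lemma adjmxM m n p (A : 'M[R[i]]_(m, n)) (B : 'M_(n, p)) :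
  (A *m B)^t* = B^t* *m A^t*.
Proof. by rewrite trmx_mul map_mxM. Qed.

Lemma adjmxB m n (A B : 'M[R[i]]_(m, n)) : (A - B)^t* = A^t* - B^t*.
Proof. by rewrite linearB map_mxB. Qed.

Lemma adjmxZ m n (c : R[i]) (A : 'M_(m, n)) : (c *: A)^t* = Num.conj c *: A^t*.
Proof. by rewrite linearZ map_mxZ. Qed.

Lemma adjmx_sum m n (I : Type) (r : seq I) (P : pred I)
    (F : I -> 'M[R[i]]_(m, n)) :
  (\sum_(i <- r | P i) F i)^t* = \sum_(i <- r | P i) (F i)^t*.
Proof. by rewrite linear_sum map_mx_sum. Qed.

Lemma hermsymmxP n (A : 'M[R[i]]_n) : A \is hermsymmx <-> A^t* = A.
Proof.
rewrite is_hermitianmxE expr0 scale1r.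
by split=> [/eqP <-|->].
Qed.

End Adjoint.

(** * Matrices diagonal in an orthonormal family: products, rank, eigenvalues, singular values *)

Section SpectralSum.
Local Open Scope sesquilinear_scope.
Variables (R : realType) (n : nat).
Implicit Types (u : 'I_n -> 'cV[R[i]]_n) (a b : 'I_n -> R) (X : 'M[R[i]]_n).

(** The coefficients are free rather than tied to [lambda], so that truncations, remainders, squares
    and projections all stay in one family. *)
Definition spectral_sum u a : 'M[R[i]]_n :=
  \sum_(i < n) (a i)%:C *: (u i *m (u i)^t*).

Lemma adj_spectral_sum u a : (spectral_sum u a)^t* = spectral_sum u a.
Proof.
rewrite adjmx_sum; apply: eq_bigr => i _.
by rewrite adjmxZ conjC_realc adjmxM trmxCK.
Qed.

Lemma spectral_sumB u a b :
  spectral_sum u a - spectral_sum u b = spectral_sum u (fun i => a i - b i).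
Proof.
rewrite -sumrB; apply: eq_bigr => i _.
by rewrite -scalerBl rmorphB.
Qed.

Lemma spectral_sum_mulmx u a b : Defs.orthonormal u ->
  spectral_sum u a *m spectral_sum u b = spectral_sum u (fun i => a i * b i).
Proof.
move=> ou; rewrite mulmx_suml; apply: eq_bigr => i _.
rewrite mulmx_sumr (bigD1 i) //= big1 ?addr0 => [|j ji].
  rewrite -scalemxAl -scalemxAr scalerA -rmorphM; congr (_ *: _).
  by rewrite -mulmxA (mulmxA _ (u i)) ou eqxx mul1mx.
rewrite -scalemxAl -scalemxAr -mulmxA (mulmxA _ (u j)) ou eq_sym (negPf ji).
by rewrite mul_scalar_mx scale0r mulmx0 !scaler0.
Qed.

Lemma mxtrace_spectral_sum u a : Defs.orthonormal u ->
  \tr (spectral_sum u a) = (\sum_(i < n) a i)%:C.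
Proof.
move=> ou; rewrite raddf_sum rmorph_sum; apply: eq_bigr => i _.
by rewrite /= mxtraceZ mxtrace_mulC ou eqxx mxtrace1 mulr1.
Qed.

Lemma quad_spectral_sum u a (v : 'cV[R[i]]_n) :
  (v^t* *m spectral_sum u a *m v) ord0 ord0 =
  \sum_(i < n) (a i)%:C * `|((u i)^t* *m v) ord0 ord0| ^+ 2.
Proof.
rewrite mulmx_sumr mulmx_suml summxE; apply: eq_bigr => i _.
rewrite -scalemxAr -scalemxAl mxE; congr (_ * _).
have -> : v^t* *m (u i *m (u i)^t*) *m v =
    ((u i)^t* *m v)^t* *m ((u i)^t* *m v).
  by rewrite adjmxM trmxCK !mulmxA.
by rewrite mxE big_ord1 2!mxE mulrC normCK.
Qed.

Lemma psd_spectral_sum u a : (forall i, 0 <= a i) -> psd (spectral_sum u a).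
Proof.
move=> a0; split; first by apply/hermsymmxP; exact: adj_spectral_sum.
move=> v; rewrite quad_spectral_sum; apply: sumr_ge0 => i _.
by rewrite mulr_ge0 ?ler0c ?exprn_ge0.
Qed.

(** The quadratic form takes the value [a i] at the vector [u i]. *)
Lemma psd_spectral_coef u a : Defs.orthonormal u -> psd (spectral_sum u a) ->
  forall i, 0 <= a i.
Proof.
move=> ou [_ psda] i; have := psda (u i).
rewrite quad_spectral_sum (bigD1 i) //= big1 ?addr0 => [|j ji].
  by rewrite ou eqxx mxE normr1 expr1n mulr1 ler0c.
by rewrite ou (negPf ji) mxE mul0rn normr0 expr0n mulr0.
Qed.

(** Only the terms in [P] survive, each of rank at most one, and rank is subadditive. *)
Lemma rank_spectral_sum u a (P : pred 'I_n) : (forall i, ~~ P i -> a i = 0) ->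
  (\rank (spectral_sum u a) <= #|P|)%N.
Proof.
move=> a0; rewrite /spectral_sum (bigID P) /= [X in _ + X]big1 => [|i /a0 ->].
  rewrite addr0 -sum1_card.
  elim/big_ind2: _ => [|B k C l Bk Cl|i _]; first by rewrite mxrank0.
    exact: leq_trans (mxrank_add _ _) (leq_add Bk Cl).
  apply: leq_trans (mxrank_scale _ _) _.
  by apply: leq_trans (mxrankM_maxl _ _) _; exact: rank_leq_col.
by rewrite scale0r.
Qed.

(** Row [i] is the adjoint of [u i]: left multiplication by this matrix gives coordinates in the
    family [u]. *)
Definition eigenbasis u : 'M[R[i]]_n := \matrix_(i, j) (u i)^t* ord0 j.

Lemma eigenbasis_unitary u : Defs.orthonormal u ->
  eigenbasis u *m (eigenbasis u)^t* = 1%:M.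
Proof.
move=> ou; apply/matrixP=> i j.
have := congr1 (fun M : 'M_1 => M ord0 ord0) (ou i j).
rewrite !mxE /= mulr1n => <-; apply: eq_bigr => k _.
by rewrite !mxE conjCK.
Qed.

(** Completeness of the family: for a square matrix [V], a right inverse [V^t*] is also a left
    inverse. *)
Lemma spectral_sum1 u : Defs.orthonormal u -> spectral_sum u (fun=> 1) = 1%:M.
Proof.
move=> ou; rewrite -(mulmx1C (eigenbasis_unitary ou)).
apply/matrixP=> k l; rewrite summxE mxE.
by apply: eq_bigr => i _; rewrite scale1r mxE big_ord1 !mxE conjCK.
Qed.

(* [Q] is the spectral projection on [P], a multiple of the sum; the identity
   splits as [Q] plus a matrix of rank at most the size of the complement. *)
Lemma rank_spectral_sum_ge u a (P : pred 'I_n) : Defs.orthonormal u ->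
  (forall i, P i -> a i != 0) -> (#|P| <= \rank (spectral_sum u a))%N.
Proof.
move=> ou a0; pose Q := spectral_sum u (fun i => (P i)%:R).
have QE : Q = spectral_sum u a *m spectral_sum u (fun i => (P i)%:R / a i).
  rewrite spectral_sum_mulmx //; apply: eq_bigr => i _; congr (_%:C *: _).
  by case Pi: (P i); rewrite ?mul0r ?mulr0 // mulrCA divff ?mulr1 // a0.
have rQ : (\rank Q <= \rank (spectral_sum u a))%N by rewrite QE mxrankM_maxl.
have rQ' : (\rank (spectral_sum u (fun=> 1) - Q)%R <= #|predC P|)%N.
  rewrite spectral_sumB; apply: rank_spectral_sum => i.
  by rewrite /= negbK => ->; rewrite subrr.
have := mxrank_add Q (spectral_sum u (fun=> 1) - Q).
rewrite addrC subrK spectral_sum1 // mxrank1 => le_n.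
rewrite -(leq_add2r #|predC P|) cardC card_ord.
by apply: leq_trans le_n _; rewrite leq_add // -(spectral_sum1 ou).
Qed.

(** Multiplying by the unitary [V] on the left turns the sum into a diagonal matrix times [V]. The
    determinant of [V], nonzero as a constant polynomial too, then cancels. *)
Lemma char_poly_spectral_sum u a : Defs.orthonormal u ->
  char_poly (spectral_sum u a) = \prod_(i < n) ('X - ((a i)%:C)%:P).
Proof.
move=> ou; pose V := eigenbasis u.
have VV : V *m V^t* = 1%:M := eigenbasis_unitary ou.
have rowV i : row i V = (u i)^t* by apply/rowP=> j; rewrite !mxE.
have VX : V *m spectral_sum u a = diag_mx (\row_i (a i)%:C) *m V.
  apply/row_matrixP=> i; rewrite !row_mul rowV row_diag_mx -scalemxAl -rowE.
  rewrite rowV mxE mulmx_sumr (bigD1 i) //= big1 ?addr0 => [|j ji].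
    by rewrite -scalemxAr mulmxA ou eqxx mul1mx.
  rewrite -scalemxAr mulmxA ou eq_sym (negPf ji).
  by rewrite mul_scalar_mx scale0r scaler0.
have VU : \det (map_mx polyC V) != 0.
  rewrite det_map_mx polyC_eq0 -unitfE -unitmxE.
  by have [] := mulmx1_unit VV.
apply: (mulfI VU); rewrite /char_poly -det_mulmx /char_poly_mx mulmxBr.
rewrite -map_mxM VX map_mxM scalar_mxC -mulmxBl det_mulmx mulrC; congr (_ * _).
have -> : 'X%:M - map_mx polyC (diag_mx (\row_i (a i)%:C)) =
    diag_mx (\row_i ('X - ((a i)%:C)%:P)) :> 'M[{poly R[i]}]_n.
  apply/matrixP=> i j; rewrite !mxE; case: eqP => [->|_].
    by rewrite !mulr1n.
  by rewrite !mulr0n polyC0 subr0.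
by rewrite det_diag; apply: eq_bigr => i _; rewrite mxE.
Qed.

Lemma perm_eigenvalues_spectral_sum u a : Defs.orthonormal u ->
  perm_eq (eigenvalues (spectral_sum u a)) (codom a).
Proof.
move=> ou; rewrite perm_sort.
have -> : codom a = [seq complex.Re z | z <- [seq (a i)%:C | i <- enum 'I_n]].
  by rewrite -map_comp; apply: eq_map.
(* A product of monic linear factors determines its roots up to order. *)
apply: perm_map; apply: prod_XsubC_eq.
case: closed_field_poly_normal => s /=.
rewrite (monicP (char_poly_monic _)) scale1r => <-.
by rewrite char_poly_spectral_sum // big_map big_enum.
Qed.

(** The eigenvalue list and the list of coefficients are permutations of each other and both
    decreasing, hence equal. *)
Lemma lambda_spectral_sum u a : Defs.orthonormal u ->
  {homo a : i j / (i <= j)%N >-> j <= i} ->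
  forall i : 'I_n, lambda (spectral_sum u a) i = a i.
Proof.
move=> ou a_dec i; rewrite /lambda.
have -> : eigenvalues (spectral_sum u a) = codom a.
  apply: (@sorted_eq _ (fun x y : R => y <= x)).
  - by move=> x y z yx zy; exact: le_trans zy yx.
  - by move=> x y /andP[yx xy]; apply: le_anti; rewrite xy.
  - by apply: sort_sorted => x y; exact: le_total.
  - rewrite sorted_map.
    apply: sub_sorted (_ : sorted (relpre val leq) (enum 'I_n)).
      by move=> k j; exact: a_dec.
    by rewrite -sorted_map val_enum_ord iota_sorted.
  - exact: perm_eigenvalues_spectral_sum.
by rewrite (nth_map i) ?size_enum_ord // nth_ord_enum.
Qed.

Lemma spectral_sum_sqr u a : Defs.orthonormal u ->
  (spectral_sum u a)^t* *m spectral_sum u a =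
  spectral_sum u (fun i => a i ^+ 2).
Proof. by move=> ou; rewrite adj_spectral_sum spectral_sum_mulmx. Qed.

Lemma nuclear_spectral_sum u a : Defs.orthonormal u -> (forall i, 0 <= a i) ->
  nuclear (spectral_sum u a) = \sum_(i < n) a i.
Proof.
move=> ou a0; rewrite /nuclear /sigma /lambda spectral_sum_sqr //.
have pe := perm_eigenvalues_spectral_sum (fun i => a i ^+ 2) ou.
(* Writing [n] as the length of the eigenvalue list turns the sum over indices into a sum over that
   list, which may then be permuted. *)
rewrite -[X in index_iota 0 X](card_ord n) -(size_codom (fun i => a i ^+ 2)).
rewrite -(perm_size pe) -(big_nth 0 xpredT Num.sqrt) (perm_big _ pe) big_map.
by rewrite big_enum; apply: eq_bigr => i _; rewrite sqrtr_sqr ger0_norm.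
Qed.

Lemma sigma_spectral_sum u a : Defs.orthonormal u -> (forall i, 0 <= a i) ->
  {homo a : i j / (i <= j)%N >-> j <= i} ->
  forall i : 'I_n, sigma (spectral_sum u a) i = a i.
Proof.
move=> ou a0 a_dec i; rewrite /sigma spectral_sum_sqr // lambda_spectral_sum //.
  by rewrite sqrtr_sqr ger0_norm.
by move=> j k /a_dec ?; rewrite ler_sqr ?nnegrE.
Qed.

(** The spectral theorem gives a unitary diagonalization with real diagonal in some order; sorting
    it reorders the basis as well. *)
Lemma hermitian_spectral_sum X : X \is hermsymmx ->
  exists u a, [/\ Defs.orthonormal u, X = spectral_sum u a &
                 {homo a : i j / (i <= j)%N >-> j <= i}].
Proof.
move=> hX; set V := spectralmx X; set d := spectral_diag X.
have VV : V *m V^t* = 1%:M by apply/unitarymxP; exact: spectral_unitarymx.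
have dR i : (complex.Re (d ord0 i))%:C = d ord0 i.
  by apply: RRe_real; apply: (mxOverP (hermitian_spectral_diag_real hX)).
have XE : X = V^t* *m diag_mx d *m V.
  rewrite -invmx_unitary ?spectral_unitarymx //.
  exact/orthomx_spectralP/hermitian_normalmx.
pose t := [tuple complex.Re (d ord0 i) | i < n].
(* [p] is the permutation that sorts the diagonal decreasingly. *)
have /tuple_permP[p pE] : perm_eq (sort >=%R t) t by rewrite perm_sort.
pose a i := complex.Re (d ord0 (p i)).
pose u i := (row (p i) V)^t*.
exists u, a; split.
- move=> i j; rewrite /u trmxCK.
  apply/matrixP=> k l; rewrite !ord1.
  have := congr1 (fun M : 'M_n => M (p i) (p j)) VV.
  rewrite !mxE (inj_eq perm_inj) /= mulr1n => <-; apply: eq_bigr => m _.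
  by rewrite !mxE.
- transitivity (\sum_(i < n) d ord0 i *: ((row i V)^t* *m row i V)).
    rewrite {1}XE; apply/matrixP=> k l; rewrite summxE mxE.
    apply: eq_bigr => i _.
    rewrite mul_mx_diag !mxE big_ord1 !mxE.
    by rewrite mulrCA mulrA.
  rewrite (reindex_inj (@perm_inj _ p)); apply: eq_bigr => i _.
  by rewrite /a dR /u trmxCK.
- have a_nth i : a i = nth 0 (sort >=%R t) i.
    by rewrite pE -tnth_nth !tnth_mktuple.
  move=> i j ij; rewrite !a_nth.
  apply: (sorted_leq_nth (leT := >=%R)) => //.
  - by move=> x y z yx zy; exact: le_trans zy yx.
  - by move=> x; exact: lexx.
  - by apply: sort_sorted => x y; exact: le_total.
  - by rewrite inE size_sort size_tuple.
  - by rewrite inE size_sort size_tuple.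
Qed.

End SpectralSum.

(** * Entry bounds for positive semidefinite matrices, and the low-rank rounding *)

Section Psd.
Local Open Scope sesquilinear_scope.
Variables (R : realType) (n : nat).
Implicit Types (A D T X Y : 'M[R[i]]_n) (c : R[i]).

Lemma adj_delta_mx m p (i : 'I_m) (j : 'I_p) :
  (delta_mx i j : 'M[R[i]]_(m, p))^t* = delta_mx j i.
Proof. by rewrite trmx_delta map_delta_mx. Qed.

Lemma delta_quad_mx A i j :
  delta_mx ord0 i *m A *m delta_mx j ord0 = (A i j)%:M :> 'M_1.
Proof. by rewrite -rowE -colE; apply/matrixP=> k l; rewrite !ord1 !mxE. Qed.

Lemma psd_diag_ge0 A i : psd A -> 0 <= A i i.
Proof.
by move=> [_ /(_ (delta_mx i ord0))]; rewrite adj_delta_mx delta_quad_mx mxE.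
Qed.

(* Test positivity on [z e_i - |z| e_j] with [z = A i j]. *)
Lemma psd_entry_le A c i j : psd A -> A i i <= c -> A j j <= c -> `|A i j| <= c.
Proof.
move=> psdA Ai Aj; set z := A i j.
have Aji : A j i = Num.conj z.
  by have [/hermsymmxP <- _] := psdA; rewrite !mxE.
have [->|z0] := eqVneq z 0.
  by rewrite normr0 (le_trans (psd_diag_ge0 i psdA)).
have [_ /(_ (z *: delta_mx i ord0 - `|z| *: delta_mx j ord0))] := psdA.
rewrite adjmxB !adjmxZ !adj_delta_mx conj_normC !(mulmxBl, mulmxBr).
rewrite -!(scalemxAl, scalemxAr) !delta_quad_mx !mxE !eqxx !mulr1n Aji -/z.
(* With [x = z], [y] its conjugate, [m = |z|], [a = A i i] and [b = A j j], the quadratic form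
   equals [|z|^2 (a + b - 2|z|)], so [2|z| <= a + b <= 2c]. *)
have expand (F : comRingType) (x y m a b : F) : m * m = x * y ->
    x * (y * a) - x * (m * y) - (y * (m * x) - m * (m * b)) =
    x * y * (a + b - m *+ 2).
  by move=> mm; rewrite (mulrA m m) mm; ring.
have mm : `|z| * `|z| = z * Num.conj z by rewrite -expr2 normCK.
rewrite (expand _ _ _ _ _ _ mm) -normCK.
rewrite pmulr_rge0 ?exprn_gt0 ?normr_gt0 // subr_ge0 => le_z.
rewrite -(ler_pMn2r (isT : (0 < 2)%N)) (le_trans le_z) // mulr2n.
by rewrite lerD.
Qed.

Lemma psd_congruence A D : psd A -> psd (D^t* *m A *m D).
Proof.
move=> [/hermsymmxP hA pA]; split.
  by apply/hermsymmxP; rewrite !adjmxM trmxCK hA mulmxA.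
move=> v; have := pA (D *m v).
by rewrite adjmxM !mulmxA.
Qed.

(** The trace is the sum of the squared moduli of [n ^ 2] entries, each at most [c ^ 2]. *)
Lemma frobenius_le A (c : R) : 0 <= c ->
  (forall i j, `|A i j| <= c%:C) -> frobenius A <= n%:R * c.
Proof.
move=> c0 Ac; rewrite /frobenius -[leRHS](ger0_norm (mulr_ge0 (ler0n _ n) c0)).
rewrite -sqrtr_sqr; apply: ler_wsqrtr.
have : \tr (A^t* *m A) <= ((n%:R * c) ^+ 2)%:C.
  have -> : ((n%:R * c) ^+ 2)%:C = \sum_(i < n) \sum_(j < n) (c ^+ 2)%:C.
    have -> : (n%:R * c) ^+ 2 = \sum_(i < n) \sum_(j < n) c ^+ 2.
      rewrite !sumr_const !card_ord -mulrnA mulnn.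
      by rewrite -[_ *+ (n ^ 2)]mulr_natl exprMn natrX.
    by rewrite rmorph_sum; apply: eq_bigr => i _; rewrite rmorph_sum.
  apply: ler_sum => i _; rewrite mxE; apply: ler_sum => j _.
  rewrite !mxE mulrC -normCK rmorphXn.
  by rewrite ler_pXn2r ?nnegrE // ler0c.
by rewrite lecE => /andP[].
Qed.

Lemma mxtrace_psd_entry_le A i : psd A -> A i i <= \tr A.
Proof.
move=> pA; rewrite /mxtrace (bigD1 i) //= lerDl sumr_ge0 // => j _.
exact: psd_diag_ge0.
Qed.

(** The all-ones matrix is the Gram matrix of a row of ones, so its form is a squared modulus. *)
Lemma Omega_ones : Omega (const_mx 1 : 'M[R[i]]_n).
Proof.
split; last by move=> i; rewrite mxE.
split; first by apply/hermsymmxP/matrixP=> i j; rewrite !mxE conjC1.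
move=> v; have -> : const_mx 1 =
    (const_mx 1 : 'rV[R[i]]_n)^t* *m const_mx 1 :> 'M[R[i]]_n.
  by apply/matrixP=> i j; rewrite !mxE big_ord1 !mxE conjC1 mulr1.
rewrite mulmxA -adjmxM -mulmxA mxE big_ord1 !mxE mulrC -normCK.
exact: exprn_ge0.
Qed.

Lemma Omega_entry_le X i j : Omega X -> `|X i j| <= 1.
Proof. by move=> [pX X1]; apply: psd_entry_le; rewrite ?X1. Qed.

Lemma low_rank_rounding (kappa : nat) X T (delta : R) : (0 < kappa)%N ->
  Omega X -> psd T -> psd (X - T) -> (\rank T <= kappa)%N ->
  \tr (X - T) = delta%:C ->
  exists2 Y, lowrank kappa Y & forall i j, `|(X - Y) i j| <= (2 * delta)%:C.
Proof.
move=> k0 OX pT pA rT trA.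
have Adiag i : (X - T) i i <= delta%:C.
  by rewrite -trA; exact: mxtrace_psd_entry_le.
have [delta1|delta1] := leP 1 delta.
  exists (const_mx 1).
    split; first exact: Omega_ones.
    apply: leq_trans k0.
    have -> : const_mx 1 =
        (const_mx 1 : 'cV[R[i]]_n) *m (const_mx 1 : 'rV[R[i]]_n).
      by apply/matrixP=> i j; rewrite !mxE big_ord1 !mxE mulr1.
    by apply: leq_trans (mxrankM_maxl _ _) _; exact: rank_leq_col.
  move=> i j; rewrite !mxE; apply: le_trans (ler_normB _ _) _.
  have := Omega_entry_le i j OX; rewrite normr1 -(lerD2r 1) => /le_trans; apply.
  by rewrite -[1 + 1]/(2%:R) -(rmorph_nat (real_complex R)) lecR ler_peMr.
(* Here [delta < 1], which makes the diagonal of [T] positive: the complex roots [r i] are positive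
   reals, and [D] below is self-adjoint. *)
pose r i := sqrtC (T i i).
have T_ge i : 1 - delta%:C <= T i i.
  have := Adiag i; rewrite !mxE; case: OX => _ ->.
  by rewrite lerBlDr addrC -lerBlDr.
have T_le i : T i i <= 1.
  have := psd_diag_ge0 i pA; rewrite !mxE; case: OX => _ ->.
  by rewrite subr_ge0.
have d1 : 0 < 1 - delta%:C :> R[i].
  by rewrite subr_gt0 -(rmorph1 (real_complex R)) ltcR.
have r_gt0 i : 0 < r i by rewrite sqrtC_gt0 (lt_le_trans d1).
have r_le1 i : r i <= 1.
  by rewrite -sqrtC1 ler_sqrtC ?nnegrE // (le_trans _ (T_ge i)) // ltW.
have r_conj i : Num.conj (r i) = r i by apply: conj_Creal; exact: gtr0_real.
pose D := diag_mx (\row_i (r i)^-1).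
have DE : D^t* = D.
  rewrite tr_diag_mx map_diag_mx; congr diag_mx; apply/rowP=> i.
  by rewrite !mxE fmorphV /= r_conj.
pose Y := D *m T *m D.
have YE i j : Y i j = (r i)^-1 * T i j * (r j)^-1.
  by rewrite /Y mul_mx_diag mul_diag_mx !mxE.
have OY : Omega Y.
  split; first by rewrite /Y -{1}DE; exact: psd_congruence.
  move=> i; rewrite YE -[T i i]sqrtCK -/(r i) expr2.
  by rewrite mulKf ?gt_eqF // divff // gt_eqF.
exists Y.
  split=> //; apply: leq_trans rT.
  by apply: leq_trans (mxrankM_maxl _ _) _; exact: mxrankM_maxr.
move=> i j.
(* Separates the truncation error [x - t] from the normalization error; each contributes at most
   [delta]. *)
have split_diff (F : fieldType) (x t a b : F) : a != 0 -> b != 0 ->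
    x - a^-1 * t * b^-1 = x - t - (1 - a * b) * (a^-1 * t * b^-1).
  by move=> a0 b0; field; rewrite a0 b0.
have -> : (X - Y) i j = (X - T) i j - (1 - r i * r j) * Y i j.
  rewrite [LHS]mxE [in LHS]mxE YE (split_diff _ _ _ (r i) (r j)) ?gt_eqF //.
  by rewrite -YE 2![in RHS]mxE.
apply: le_trans (ler_normB _ _) _.
rewrite mulr_natl rmorphMn mulr2n lerD //; first exact: psd_entry_le.
have rr_le1 : r i * r j <= 1 by rewrite mulr_ile1 // ltW.
rewrite normrM ger0_norm ?subr_ge0 // -[leRHS]mulr1.
apply: ler_pM; rewrite ?subr_ge0 //; last exact: Omega_entry_le.
rewrite lerBlDr addrC -lerBlDr.
(* Squaring removes the roots: it remains that [(1 - delta)^2 <= T i i * T j j]. *)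
rewrite -(@ler_pXn2r _ 2) ?nnegrE ?(ltW d1) ?mulr_ge0 ?(ltW (r_gt0 _)) //.
by rewrite exprMn !sqrtCK expr2 ler_pM // (ltW d1).
Qed.

Lemma card_ord_lt m : #|[pred i : 'I_n | (i < m)%N]| = minn m n.
Proof.
rewrite -sum1_card; have [mn|/ltnW nm] := leqP m n.
  by rewrite -(big_ord_widen n (fun=> 1%N) mn) sum1_card card_ord.
rewrite (eq_bigl xpredT) => [|i]; first by rewrite sum1_card card_ord.
by rewrite inE (leq_trans (ltn_ord i)).
Qed.

(** If some coefficient of index [i >= kappa] were nonzero, it would be positive, and so would all
    those of index [0] to [kappa], forcing rank at least [kappa.+1]. *)
Lemma lowrank_sum_sigma (kappa : nat) Y : psd Y -> (\rank Y <= kappa)%N ->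
  \sum_(kappa <= i < n) sigma Y i = 0.
Proof.
move=> pY rY; have [u [a [ou YE a_dec]]] := hermitian_spectral_sum pY.1.
have a0 : forall i, 0 <= a i by apply: (psd_spectral_coef ou); rewrite -YE.
rewrite big_geq_mkord big1 // => i /= ki; rewrite YE sigma_spectral_sum //.
apply/eqP/negPn/negP => ai.
have : (#|[pred j : 'I_n | (j < kappa.+1)%N]| <= \rank Y)%N.
  rewrite YE; apply: rank_spectral_sum_ge => // j; rewrite inE ltnS => jk.
  rewrite gt_eqF // (lt_le_trans _ (a_dec _ _ (leq_trans jk ki))) //.
  by rewrite lt_def ai a0.
rewrite card_ord_lt (minn_idPl (leq_ltn_trans ki (ltn_ord i))).
by move=> /leq_trans/(_ rY); rewrite ltnn.
Qed.

End Psd.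

(** * Rounding a feasible matrix given by a spectral sum *)

Section Truncation.
Variables (R : realType) (n kappa : nat).
Implicit Types (X : 'M[R[i]]_n) (u : 'I_n -> 'cV[R[i]]_n) (a : 'I_n -> R).

Definition tail a (i : 'I_n) : R := if (i < kappa)%N then 0 else a i.

Lemma tail_ge0 a : (forall i, 0 <= a i) -> forall i, 0 <= tail a i.
Proof. by move=> a0 i; rewrite /tail; case: ifP. Qed.

Lemma truncation_tail X u : eigen_decomposition X u ->
  X - truncation kappa X u = spectral_sum u (tail (fun i => lambda X i)).
Proof.
move=> [_ XE]; rewrite /truncation big_mkcond {1}XE -sumrB.
apply: eq_bigr => i _.
by rewrite /tail; case: ifP => _; rewrite ?subrr ?subr0 // scale0r.
Qed.

(** Serves both conclusions of the theorem: the first with coefficients [lambda X i], the second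
    with those supplied by the spectral theorem. *)
Lemma spectral_rounding X u a : (0 < kappa)%N -> Omega X ->
  Defs.orthonormal u -> X = spectral_sum u a ->
  exists2 Y, lowrank kappa Y &
    forall i j, `|(X - Y) i j| <= (2 * \sum_(i < n) tail a i)%:C.
Proof.
move=> k0 OX ou XE.
have a0 : forall i, 0 <= a i.
  by apply: (psd_spectral_coef ou); rewrite -XE; case: OX.
(* The coefficient is [a i] below [kappa] and [0] from there on. *)
pose T := spectral_sum u (fun i => a i - tail a i).
have XT : X - T = spectral_sum u (tail a).
  by rewrite XE spectral_sumB; apply: eq_bigr => i _; rewrite subKr.
apply: (low_rank_rounding (T := T)) => //.
- apply: psd_spectral_sum => i; rewrite /tail; case: ifP => _.
    by rewrite subr0.
  by rewrite subrr.
- by rewrite XT; apply: psd_spectral_sum; exact: tail_ge0.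
- apply: leq_trans
      (rank_spectral_sum (P := [pred i : 'I_n | (i < kappa)%N]) _ _) _.
    by move=> i /= /negPf ik; rewrite /tail ik subrr.
  by rewrite card_ord_lt geq_minl.
- by rewrite XT mxtrace_spectral_sum.
Qed.

End Truncation.

Theorem proposition2p3 (R : realType) (n kappa : nat) (hkappa : (0 < kappa)%N) :
  (forall (X : 'M[R[i]]_n) (u : 'I_n -> 'cV[R[i]]_n),
     Omega X -> eigen_decomposition X u ->
     (dist X (@lowrank R n kappa)
       <= ((1 + 2 * n%:R) * nuclear (X - truncation kappa X u))%:E)%E)
  /\
  (forall t : R,
     @Gamma R n kappa t `<=`
     [set Y + ((1 + 2 * n%:R) * `|t|)%:C *: Z
       | Y in @Gamma R n kappa 0 & Z in @hermitian_ball R n]).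
Proof.
split=> [X u OX [ou XE]|t X [OX tE]].
  have l0 : forall i : 'I_n, 0 <= lambda X i.
    apply: (psd_spectral_coef (a := fun i => lambda X i) ou).
    by rewrite -[spectral_sum _ _]XE; case: OX.
  have t0 := tail_ge0 kappa l0.
  have [Y lrY XY] := spectral_rounding hkappa OX ou XE.
  rewrite (truncation_tail kappa (conj ou XE)) nuclear_spectral_sum //.
  set delta := \sum_(i < n) _ in XY *.
  have d0 : 0 <= delta by exact: sumr_ge0.
  apply: le_trans (ereal_inf_lbound _) _; first by exists Y.
  (* The entry bound gives [2 n delta], which is at most [(1 + 2 n) delta]. *)
  rewrite lee_fin (le_trans (frobenius_le _ XY)) ?mulr_ge0 // mulrA.
  by rewrite ler_wpM2r // [n%:R * 2]mulrC lerDr.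
have [u [a [ou XE a_dec]]] := hermitian_spectral_sum (OX.1).1.
have a0 : forall i, 0 <= a i.
  by apply: (psd_spectral_coef ou); rewrite -XE; case: OX.
have [Y [OY rY] XY] := spectral_rounding hkappa OX ou XE.
(* The coefficients are nonnegative and decreasing, so they are the singular values in order. *)
have tailE : \sum_(i < n) tail kappa a i = t.
  rewrite -tE XE big_geq_mkord [RHS]big_mkcond; apply: eq_bigr => i _.
  by rewrite /tail; case: ltnP => //= _; rewrite sigma_spectral_sum.
have t_ge0 : 0 <= t.
  by rewrite -tailE; apply: sumr_ge0 => i _; exact: tail_ge0.
rewrite tailE in XY.
have hXY : X - Y \is hermsymmx.
  have /hermsymmxP hX := OX.1.1; have /hermsymmxP hY := OY.1.1.
  by apply/hermsymmxP; rewrite adjmxB hX hY.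
exists Y; first by split=> //; apply: lowrank_sum_sigma => //; case: OY.
pose c := (1 + 2 * n%:R) * t.
rewrite (ger0_norm t_ge0) -/c.
have k_gt0 : 0 < 1 + 2 * n%:R :> R by rewrite ltr_pwDl ?mulr_ge0.
have c_ge0 : 0 <= c by rewrite mulr_ge0 // ltW.
(* For [t = 0] also [c = 0], and the convention that the inverse of [0] is [0] makes this witness
   the zero matrix. *)
exists ((c^-1)%:C *: (X - Y)).
  split.
    apply/hermsymmxP; rewrite adjmxZ conjC_realc.
    by move/hermsymmxP: hXY => ->.
  apply: le_trans (frobenius_le (c := c^-1 * (2 * t)) _ _) _.
  - by rewrite !mulr_ge0 ?invr_ge0.
  - move=> i j; rewrite mxE normrM rmorphM ger0_norm ?ler0c ?invr_ge0 //.
    by rewrite ler_wpM2l // ler0c invr_ge0.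
  - have [->|t0] := eqVneq t 0; first by rewrite !mulr0.
    have c_gt0 : 0 < c by rewrite lt_def c_ge0 mulf_neq0 // gt_eqF.
    rewrite mulrCA ler_pdivrMl // mulr1 mulrA [n%:R * 2]mulrC.
    by rewrite ler_wpM2r // lerDr.
(* If [t = 0], the entry bound [2 t] forces [X = Y]; otherwise [c] cancels its inverse. *)
have [t0|t0] := eqVneq t 0.
  rewrite /c t0 mulr0 scale0r addr0; apply/eqP; rewrite eq_sym -subr_eq0.
  apply/eqP/matrixP => i j; have := XY i j.
  by rewrite t0 mulr0 normr_le0 => /eqP ->; rewrite mxE.
have c_neq0 : c != 0.
  by rewrite mulf_neq0 // gt_eqF.
by rewrite scalerA -rmorphM divff // rmorph1 scale1r addrC subrK.
Qed.
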